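(* Let $M$ be a smooth manifold, let $F$ be a smooth vector field on $M$, and let $\mathcal{S}:M\to M$ be a diffeomorphism with $\mathcal{S}\neq\mathrm{id}$ and $\mathcal{S}^{-1}=\mathcal{S}$. Suppose that $F$ has $\mathcal{S}$ as a symmetry, i.e. $\mathcal{S}_*F=F\mathcal{S}$. Let $p\ge 1$ be an integer and let $\varphi_h(t)=\exp(tF_h)$ be the flow of a self-adjoint numerical method of order $2p$ for $\dot y=F(y)$, that is, with modified vector field the formal series $$F_h=F+h^{2p}E_{2p}+h^{2p+2}E_{2p+2}+\cdots$$ containing only even powers of $h$, where each $E_j$ is a smooth vector field, decomposed as $E_j=P_j+K_j$ with $P_j\in\mathfrak{p}$, $K_j\in\mathfrak{k}$. Set $$a=\frac{1}{2+2^{1/(2p+1)}},\qquad b=1-2a,$$ and define the composition $$\varphi^{[1]}_h(t)=\varphi_{ah}(at)\,\sigma\bigl(\varphi_{bh}(bt)\bigr)\,\varphi_{ah}(at).$$ Then the numerical method $\varphi^{[1]}_h(h)$ (obtained by setting $t=h$) retains the symmetry $\mathcal{S}$ to order $2p+2$: writing $\varphi^{[1]}_h(h)=\exp(Z_h)$ as a formal power series in $h$, the $\mathfrak{p}$-component of $Z_h$ satisfies $\tfrac12\bigl(Z_h-\mathrm{d}\sigma(Z_h)\bigr)=O(h^{2p+3})$.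
   Context: Products of maps denote composition. $\mathcal{S}_*$ is the tangent map of $\mathcal{S}$. The involutive automorphism is $\sigma(\varphi)=\mathcal{S}\varphi\mathcal{S}$, acting on maps $\varphi$ of $M$. It induces the involutive automorphism $\mathrm{d}\sigma(X)=\mathcal{S}_*X\mathcal{S}$ on smooth vector fields, i.e. $(\mathrm{d}\sigma X)(x)=T\mathcal{S}\bigl(X(\mathcal{S}x)\bigr)$, extended coefficientwise to formal power series in $h$, and $\sigma(\exp(X))=\exp(\mathrm{d}\sigma(X))$. The eigenspaces of $\mathrm{d}\sigma$ are $$\mathfrak{k}=\{K:\mathcal{S}_*K=K\mathcal{S}\}=\{K:\mathrm{d}\sigma(K)=K\},\qquad \mathfrak{p}=\{P:\mathcal{S}_*P=-P\mathcal{S}\}=\{P:\mathrm{d}\sigma(P)=-P\},$$ so that every vector field $X$ splits uniquely as $X=P+K$ with $P=\tfrac12(X-\mathrm{d}\sigma(X))\in\mathfrak{p}$ and $K=\tfrac12(X+\mathrm{d}\sigma(X))\in\mathfrak{k}$. Backward error analysis: a one-step numerical method with step size $h$ is represented as $\varphi_h(h)$, where $\varphi_h(t)=\exp(tF_h)$ is the flow of a modified vector field $F_h$, a formal power series in $h$ whose coefficients are vector fields. All identities are understood in the sense of formal power series in $h$, where $\exp$ of a formal series of vector fields (with no constant term) is the formal flow (the exponential series of the corresponding differential operator), and compositions are computed by the Baker–Campbell–Hausdorff formula. The method is self-adjoint if $\varphi_{-h}(-t)=\varphi_h(t)^{-1}$, equivalently $F_{-h}=F_h$. A method $\exp(Z_h)$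 retains the symmetry $\mathcal{S}$ to order $q$ (has symmetry error of order $q$) if the $\mathfrak{p}$-component of $Z_h$ is $O(h^{q+1})$. Here $O(h^m)$ means that all coefficients of $h^j$ with $j<m$ vanish. *)

(* Defs.v *)
From HB Require Import structures.
From mathcomp Require Import all_boot all_order all_algebra.
From mathcomp Require Import all_classical all_reals all_analysis.
From mathcomp Require Import ring.
Set Implicit Arguments.
Unset Strict Implicit.
Unset Printing Implicit Defensive.
Import Order.TTheory GRing.Theory Num.Theory.
Import numFieldNormedType.Exports.
Local Open Scope classical_set_scope.
Local Open Scope ring_scope.

Section Smooth.
Context {R : realType}.

(* [f] is of class C^k on [U]; only meaningful when [U] is open. *)
Fixpoint Ck {V W : normedModType R} (U : set V) (k : nat) (f : V -> W) : Prop :=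
  if k is k'.+1 then
    (forall x, U x -> differentiable f x) /\
    (forall v : V, Ck U k' (fun x => 'D_v f x))
  else forall x, U x -> {for x, continuous f}.

Definition smooth_on {V W : normedModType R} (U : set V) (f : V -> W) : Prop :=
  forall k, Ck U k f.

Lemma near_eq_differentiable (V W : normedModType R) (f g : V -> W) x :
  (\forall y \near x, f y = g y) -> differentiable f x -> differentiable g x.
Proof.
move=> fg df.
have fgx : f x = g x by exact: nbhs_singleton fg.
have H : g \o shift x = cst (g x) + 'd f x +o_ 0 id.
  apply/eqaddoP => e e0.
  have [_ /eqaddoP /(_ e e0)] := (diff_locallyP x f).1 df.
  have fg0 : \forall h \near 0, f (h + x) = g (h + x).
    by move: fg; rewrite (near_shift 0) /= subr0.
  apply: filterS2 fg0 => h /= fgh.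
  by rewrite /shift /= !fctE /cst /= fgx fgh.
have dfc : continuous ('d f x) by exact: diff_continuous.
have dg : 'd g x = 'd f x :> (V -> W) by exact: diff_unique.
by apply/diff_locallyP; rewrite dg.
Qed.

Section Closure.
Variables (V : normedModType R) (U : set V).
Hypothesis oU : open U.

Lemma near_open (P : V -> Prop) x : U x -> (forall y, U y -> P y) ->
  \forall y \near x, P y.
Proof. by move=> Ux UP; apply: filterS (open_nbhs_nbhs (conj oU Ux)). Qed.

Lemma Ck_eq (W : normedModType R) k (f g : V -> W) :
  (forall x, U x -> f x = g x) -> Ck U k f -> Ck U k g.
Proof.
elim: k f g => [|k IH] f g fg /=.
  move=> cf x Ux; have nfg : \forall y \near x, f y = g y by exact: near_open.
  rewrite /prop_for /continuous_at -(fg x Ux).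
  apply: cvg_trans (cf x Ux); exact: near_eq_cvg.
case=> df Df; split=> [x Ux|v].
  by apply: near_eq_differentiable (df x Ux); exact: near_open.
by apply: IH (Df v) => x Ux; apply: near_eq_derive; exact: near_open.
Qed.

Lemma CkW (W : normedModType R) k (f : V -> W) : Ck U k.+1 f -> Ck U k f.
Proof.
elim: k f => [|k IH] f [df Df].
  by move=> x Ux; exact: differentiable_continuous (df x Ux).
by split=> // v; apply: IH; exact: Df.
Qed.

Lemma Ck_cst (W : normedModType R) k (c : W) : Ck U k (fun=> c).
Proof.
elim: k c => [|k IH] c /=; first by move=> x _; exact: cvg_cst.
split=> [x _|v]; first exact: differentiable_cst.
by apply: Ck_eq (IH 0) => x _; rewrite derive_cst.
Qed.

Lemma CkD (W : normedModType R) k (f g : V -> W) :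
  Ck U k f -> Ck U k g -> Ck U k (fun x => f x + g x).
Proof.
elim: k f g => [|k IH] f g /=.
  by move=> cf cg x Ux; apply: continuousD; [exact: cf|exact: cg].
move=> [df Df] [dg Dg]; split=> [x Ux|v].
  by apply: differentiableD; [exact: df|exact: dg].
apply: Ck_eq (IH _ _ (Df v) (Dg v)) => x Ux.
by rewrite deriveD //; apply: diff_derivable; [exact: df|exact: dg].
Qed.

Lemma Ck_sum (W : normedModType R) k n (f : 'I_n -> V -> W) :
  (forall i, Ck U k (f i)) -> Ck U k (fun x => \sum_i f i x).
Proof.
elim: n f => [|n IH] f cf.
  by apply: Ck_eq (Ck_cst k 0) => x _; rewrite big_ord0.
apply: (@Ck_eq _ _ (fun x => f ord0 x + \sum_(i < n) f (lift ord0 i) x)).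
  by move=> x _; rewrite big_ord_recl.
by apply: CkD => //; apply: IH.
Qed.

Lemma CkM k (f g : V -> R^o) :
  Ck U k f -> Ck U k g -> Ck U k (fun x => f x * g x : R^o).
Proof.
elim: k f g => [|k IH] f g.
  by move=> cf cg x Ux; apply: continuousM; [exact: cf|exact: cg].
move=> cf cg; have [cf' cg'] := (CkW cf, CkW cg).
case: cf cg => [df Df] [dg Dg]; split=> [x Ux|v].
  by apply: differentiableM; [exact: df|exact: dg].
apply: Ck_eq (CkD (IH _ _ cf' (Dg v)) (IH _ _ cg' (Df v))) => x Ux.
by rewrite deriveM //; apply: diff_derivable; [exact: df|exact: dg].
Qed.

End Closure.

Lemma Ck_local (V W : normedModType R) (U : set V) k (f : V -> W) :
  (forall x, U x -> exists2 A : set V, A x & Ck A k f) -> Ck U k f.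
Proof.
elim: k f => [|k IH] f Uf /=.
  by move=> x /Uf[A Ax]; exact.
split=> [x /Uf[A Ax [df _]]|v]; first exact: df.
by apply: IH => x /Uf[A Ax [_ Df]]; exists A => //; exact: Df.
Qed.

Lemma derive_coord n (V : normedModType R) (g : V -> 'rV[R]_n) x v i :
  differentiable g x -> 'D_v (fun y => g y ord0 i : R^o) x = 'D_v g x ord0 i.
Proof.
move=> dg; have dc := differentiable_coord (g x) ord0 i.
rewrite !deriveE //; last exact: (@differentiable_comp _ _ _ _ g (fun N : 'rV_n => N ord0 i : R^o)).
rewrite (@diff_comp _ _ _ _ g (fun N : 'rV_n => N ord0 i : R^o)) //=.
have @f : {linear 'rV[R]_n -> R^o}.
  by exists (fun N : 'rV[R]_n => N ord0 i); do 2![eexists]; do ?[constructor];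
     rewrite ?mxE// => ? *; rewrite ?mxE//; move=> ?; rewrite !mxE.
rewrite (_ : (fun N : 'rV_n => N ord0 i : R^o) = f) // diff_lin //.
exact: coord_continuous.
Qed.

Lemma Ck_coord n (V : normedModType R) (U : set V) k (g : V -> 'rV[R]_n) i :
  open U -> Ck U k g -> Ck U k (fun y => g y ord0 i : R^o).
Proof.
move=> oU; elim: k g => [|k IH] g /=.
  move=> cg x Ux; apply: (@continuous_comp _ _ _ g (fun N : 'rV_n => N ord0 i : R^o)).
    exact: cg.
  exact: coord_continuous.
move=> [dg Dg]; split=> [x Ux|v].
  apply: (@differentiable_comp _ _ _ _ g (fun N : 'rV_n => N ord0 i : R^o)).
    exact: dg.
  exact: differentiable_coord.
apply: Ck_eq (IH _ (Dg v)) => // x Ux; rewrite derive_coord //; exact: dg.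
Qed.

Lemma Ck_comp n (V : normedModType R) (U : set V) (U' : set 'rV[R]_n) k
    (g : V -> 'rV[R]_n) (f : 'rV[R]_n -> R^o) :
  open U -> (forall x, U x -> U' (g x)) ->
  Ck U k g -> Ck U' k f -> Ck U k (fun x => f (g x)).
Proof.
move=> oU gU; elim: k f => [|k IH] f.
  by move=> cg cf x Ux; apply: continuous_comp; [exact: cg|exact/cf/gU].
move=> cg; have cg' := CkW cg; case: cg => dg Dg [df Df]; split=> [x Ux|v].
  by apply: differentiable_comp; [exact: dg|exact/df/gU].
apply: (@Ck_eq _ _ oU _ _ (fun x => \sum_(i < n)
    (('D_v g x ord0 i : R^o) * ('D_(delta_mx ord0 i) f (g x))))).
  move=> x Ux; have dgx := dg x Ux; have dfx := df _ (gU x Ux).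
  rewrite [RHS]deriveE; last exact: differentiable_comp.
  rewrite diff_comp //= -[X in 'd f (g x) X](deriveE _ dgx).
  rewrite [X in 'd f (g x) X]row_sum_delta linear_sum; apply: eq_bigr => i _.
  by rewrite linearZ /= (deriveE _ dfx).
apply: Ck_sum => // i; apply: CkM => //; first by apply: Ck_coord => //; exact: Dg.
exact: (IH (fun y => 'D_(delta_mx ord0 i) f y) cg' (Df _)).
Qed.

End Smooth.

Section Manifold.
Variable R : realType.

(* The domain is [cdom]; the values of [cmap] outside [cdom] and of [cinv]
   outside the image [cmap @` cdom] are irrelevant. *)
Record chart (n : nat) (T : topologicalType) := Chart {
  cdom : set T;
  cmap : T -> 'rV[R]_n;
  cinv : 'rV[R]_n -> T;
  cdom_open : open cdom;
  cimg_open : open (cmap @` cdom);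
  cmapK : forall x, cdom x -> cinv (cmap x) = x;
  cmap_continuous : {in cdom, continuous cmap};
  cinv_continuous : {in cmap @` cdom, continuous cinv} }.

Arguments cdom_open {n T} c.
Arguments cimg_open {n T} c.

Record manifold (n : nat) := Manifold {
  carrier :> topologicalType;
  _ : hausdorff_space carrier;
  _ : @second_countable carrier;
  atlas : set (chart n carrier);
  atlas_cover : forall x, exists2 c, atlas c & cdom c x;
  atlas_smooth : forall c d, atlas c -> atlas d ->
    smooth_on (cmap c @` (cdom c `&` cdom d)) (fun y => cmap d (cinv c y)) }.

Definition smooth_fun n (M : manifold n) (f : M -> R^o) : Prop :=
  forall c, atlas c -> smooth_on (cmap c @` cdom c) (fun y => f (cinv c y)).

Record smooth_map n m (M : manifold n) (N : manifold m) := SmoothMap {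
  smap :> M -> N;
  smap_continuous : continuous smap;
  smap_smooth : forall c d, atlas c -> atlas d ->
    smooth_on (cmap c @` (cdom c `&` smap @^-1` cdom d))
              (fun y => cmap d (smap (cinv c y))) }.

Lemma chart_img_open n (T : topologicalType) (c : chart n T) (A : set T) :
  open A -> open (cmap c @` (cdom c `&` A)).
Proof.
move=> oA; rewrite openE => _ [x [cx Ax] <-].
have iV : (cmap c @` cdom c) (cmap c x) by exists x.
have cc := cinv_continuous (mem_set iV).
have nA : nbhs (cinv c (cmap c x)) A.
  by rewrite cmapK //; exact: open_nbhs_nbhs.
have nV := open_nbhs_nbhs (conj (cimg_open c) iV).
have nA' : \forall z \near cmap c x, A (cinv c z) := cc _ nA.
apply: filterS2 nA' nV => z Az [x' cx' zx']; exists x' => //.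
by split=> //; move: Az; rewrite /= -zx' cmapK.
Qed.

Lemma smooth_fun_comp n m (M : manifold n) (N : manifold m)
    (g : smooth_map M N) (f : N -> R^o) :
  smooth_fun f -> smooth_fun (fun x => f (g x)).
Proof.
move=> sf c ac k; apply: Ck_local => _ [x cx <-].
have [d ad dgx] := atlas_cover (g x).
exists (cmap c @` (cdom c `&` g @^-1` cdom d)); first by exists x.
have oW : open (cmap c @` (cdom c `&` g @^-1` cdom d)).
  apply: chart_img_open; apply: open_comp (cdom_open d) => y _.
  exact: smap_continuous.
have H := @Ck_comp _ _ _ _ (cmap d @` cdom d) k _ _ oW _
  (smap_smooth g ac ad k) (sf d ad k).
apply: (Ck_eq oW) (H _) => [_ [y [cy dy] <-]|_ [y [cy dy] <-]];
  by rewrite ?cmapK.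
Qed.

Section SmoothFunctions.
Variables (n : nat) (M : manifold n).

Definition smooth_pred : {pred (M -> R^o)} := [pred f | `[< smooth_fun f >]].

(* C^oo(M) as a commutative ring and an R-module. *)
Record Cinf := MkCinf { Cinf_val :> M -> R^o ; _ : Cinf_val \in smooth_pred }.

HB.instance Definition _ := [isSub for Cinf_val].
HB.instance Definition _ := [Choice of Cinf by <:].

Lemma smooth_subring_closed : subring_closed smooth_pred.
Proof.
split.
- apply/asboolP => c _ k. exact: (Ck_cst (cimg_open c) k (1 : R^o)).
- move=> f g /asboolP sf /asboolP sg; apply/asboolP => c ac k.
  have H := CkM (cimg_open c) (Ck_cst (cimg_open c) k (-1 : R^o)) (sg c ac k).
  apply: (Ck_eq (cimg_open c)) (CkD (cimg_open c) (sf c ac k) H).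
  by move=> y _; rewrite mulN1r.
- move=> f g /asboolP sf /asboolP sg; apply/asboolP => c ac k.
  by apply: (Ck_eq (cimg_open c)) (CkM (cimg_open c) (sf c ac k) (sg c ac k)).
Qed.

HB.instance Definition _ :=
  GRing.isSubringClosed.Build (M -> R^o) smooth_pred smooth_subring_closed.
HB.instance Definition _ := 
  GRing.SubChoice_isSubComPzRing.Build (M -> R^o) smooth_pred Cinf
    smooth_subring_closed.

Lemma smooth_scaler_closed : scaler_closed smooth_pred.
Proof.
move=> a f /asboolP sf; apply/asboolP => c ac k.
by apply: (Ck_eq (cimg_open c))
  (CkM (cimg_open c) (Ck_cst (cimg_open c) k (a : R^o)) (sf c ac k)).
Qed.

HB.instance Definition _ :=
  GRing.isScaleClosed.Build R (M -> R^o) smooth_pred smooth_scaler_closed.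
HB.instance Definition _ := [SubZmodule_isSubLmodule of Cinf by <:].

Lemma Cinf_smooth (f : Cinf) : smooth_fun f.
Proof. by case: f => f /= /asboolP. Qed.

Definition mkCinf (f : M -> R^o) (sf : smooth_fun f) : Cinf :=
  MkCinf (introT (asboolP _) sf : f \in smooth_pred).

(* Tangent vectors at [x] are the derivations of C^oo(M) at [x]. *)
Definition tangent (x : M) (v : Cinf -> R^o) : Prop :=
  [/\ forall (a : R) (f g : Cinf), v (a *: f + g) = a * v f + v g
    & forall f g : Cinf, v (f * g) = v f * g x + f x * v g].

Definition vfield_pred : {pred (M -> Cinf -> R^o)} :=
  [pred X | `[< (forall x, tangent x (X x)) /\
                (forall f, smooth_fun (fun x => X x f)) >]].

(* Smooth vector fields, as an R-module. *)
Record vfield := MkVfield {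
  vfield_val :> M -> Cinf -> R^o ; _ : vfield_val \in vfield_pred }.

HB.instance Definition _ := [isSub for vfield_val].
HB.instance Definition _ := [Choice of vfield by <:].

Lemma vfield_submod_closed : submod_closed vfield_pred.
Proof.
split.
  apply/asboolP; split=> [x|f]; last exact: Cinf_smooth (0 : Cinf).
  split=> [a f g|f g].
    by change (0 = a * 0 + 0 :> R); rewrite mulr0 addr0.
  by change (0 = 0 * g x + f x * 0 :> R); rewrite mul0r mulr0 addr0.
move=> a X Y /asboolP[tX sX] /asboolP[tY sY]; apply/asboolP; split=> [x|f].
  have [lX dX] := tX x; have [lY dY] := tY x.
  split=> [b f g|f g].
    change (a * X x (b *: f + g) + Y x (b *: f + g) =
      b * (a * X x f + Y x f) + (a * X x g + Y x g)).
    by rewrite lX lY; ring.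
  change (a * X x (f * g) + Y x (f * g) =
    (a * X x f + Y x f) * g x + f x * (a * X x g + Y x g)).
  by rewrite dX dY; ring.
exact: Cinf_smooth (a *: mkCinf (sX f) + mkCinf (sY f)).
Qed.

HB.instance Definition _ :=
  GRing.isSubmodClosed.Build R (M -> Cinf -> R^o) vfield_pred vfield_submod_closed.
HB.instance Definition _ := [SubChoice_isSubLmodule of vfield by <:].

Lemma vfield_tangent (X : vfield) x : tangent x (X x).
Proof. by case: X => X /= /asboolP[]. Qed.

Lemma vfield_smooth (X : vfield) f : smooth_fun (fun x => X x f).
Proof. by case: X => X /= /asboolP[]. Qed.

Definition lie (X : vfield) (f : Cinf) : Cinf := mkCinf (vfield_smooth X f).

End SmoothFunctions.

Definition pullback n m (M : manifold n) (N : manifold m) (g : smooth_map M N)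
    (f : Cinf N) : Cinf M :=
  mkCinf (smooth_fun_comp g (Cinf_smooth f)).

(* The tangent map: it sends [tangent x] into [tangent (g x)]. *)
Definition tmap n m (M : manifold n) (N : manifold m) (g : smooth_map M N)
    (v : Cinf M -> R^o) : Cinf N -> R^o :=
  fun f => v (pullback g f).

Lemma tmap_tangent n m (M : manifold n) (N : manifold m) (g : smooth_map M N)
    x v : tangent x v -> tangent (g x) (tmap g v).
Proof.
move=> [lv dv]; split=> [a f h|f h]; rewrite /tmap.
  by rewrite -lv; congr v; apply/val_inj/funext.
by rewrite -[f (g x)]/(pullback g f x) -[h (g x)]/(pullback g h x) -dv;
   congr v; apply/val_inj/funext.
Qed.

Definition diffeomorphism n m (M : manifold n) (N : manifold m)
    (g : smooth_map M N) : Prop :=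
  exists g' : smooth_map N M, cancel g g' /\ cancel g' g.

Section Involution.
Variables (n : nat) (M : manifold n) (S : smooth_map M M).
Hypothesis SK : involutive S.

Lemma dsigma_subproof (X : vfield M) :
  (fun x => tmap S (X (S x))) \in @vfield_pred n M.
Proof.
apply/asboolP; split=> [x|f].
  by rewrite -{1}(SK x); apply/tmap_tangent/vfield_tangent.
exact: Cinf_smooth (pullback S (lie X (pullback S f))).
Qed.

(* d sigma (X) = S_* X S. *)
Definition dsigma (X : vfield M) : vfield M := MkVfield (dsigma_subproof X).

Definition p_component (X : vfield M) : vfield M := 2^-1 *: (X - dsigma X).

End Involution.

(* Formal power series in h with coefficients in [V] are sequences [nat -> V],
   [X j] being the coefficient of h^j. *)
Definition is_bigO (V : nmodType) (m : nat) (X : nat -> V) : Prop :=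
  forall j, (j < m)%N -> X j = 0.

Section FormalMaps.
Variables (n : nat) (M : manifold n).

(* X_{ch} and c h X_h for a formal series X_h of vector fields. *)
Definition hsubst (c : R) (X : nat -> vfield M) : nat -> vfield M :=
  fun j => c ^+ j *: X j.
Definition hmul (c : R) (X : nat -> vfield M) : nat -> vfield M :=
  fun j => if j is j'.+1 then c *: X j' else 0.

(* A formal map of M is represented by its pullback f |-> f \o phi, a formal
   series of operators on C^oo(M). *)
Definition formal_map := nat -> Cinf M -> Cinf M.

Definition op_id : formal_map := fun j => if j is 0 then idfun else 0.
Definition op_mul (A B : formal_map) : formal_map :=
  fun j => \sum_(i < j.+1) (A i \o B (j - i)%N).
Definition op_exp (k : nat) (A : formal_map) : formal_map := iter k (op_mul A) op_id.

(* Pullback reverses the order of composition. *)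
Definition fcomp (phi psi : formal_map) : formal_map := op_mul psi phi.

(* The exponential series; as [X] is meant to have no constant term, X^k does
   not contribute to the coefficient of h^j for k > j. *)
Definition fexp (X : nat -> vfield M) : formal_map :=
  fun j => \sum_(k < j.+1) (k`!%:R^-1 : R) *: op_exp k (fun i => lie (X i)) j.

Definition fmap_of (g : smooth_map M M) : formal_map :=
  fun j => if j is 0 then pullback g else 0.

Definition fsigma (S : smooth_map M M) (phi : formal_map) : formal_map :=
  fcomp (fmap_of S) (fcomp phi (fmap_of S)).

(* phi_{alpha h}(beta h), where phi_h(t) = exp(t F_h). *)
Definition fflow (Fh : nat -> vfield M) (alpha beta : R) : formal_map :=
  fexp (hmul beta (hsubst alpha Fh)).

(* phi^[1]_h(tau h) = phi_{ah}(a tau h) sigma(phi_{bh}(b tau h)) phi_{ah}(a tau h). *)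
Definition phi1 (S : smooth_map M M) (Fh : nat -> vfield M) (a b tau : R) :
    formal_map :=
  fcomp (fflow Fh a (a * tau))
    (fcomp (fsigma S (fflow Fh b (b * tau))) (fflow Fh a (a * tau))).

(* F + h^{2p} E_{2p} + h^{2p+2} E_{2p+2} + ...; having only even powers of h,
   i.e. F_{-h} = F_h, is the self-adjointness of the method. *)
Definition modified_field (p : nat) (F : vfield M) (E : nat -> vfield M) :
    nat -> vfield M :=
  fun j => if j == 0%N then F
           else if (2 * p <= j)%N && ~~ odd j then E j else 0.

End FormalMaps.
End Manifold.

Definition retains_symmetry (R : realType) n (M : manifold R n)
    (S : smooth_map M M) (SK : involutive S) (q : nat) (phi : formal_map M) : Prop :=
  exists Z : nat -> vfield M,
    [/\ Z 0%N = 0, fexp Z = phi & is_bigO q.+1 (fun j => p_component SK (Z j))].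

(* Main.v *)
Require Import Defs.
From HB Require Import structures.
From mathcomp Require Import all_boot all_order all_algebra.
From mathcomp Require Import all_classical all_reals all_analysis.
From mathcomp Require Import ring zify.
Import GRing.Theory Num.Theory.
Local Open Scope ring_scope.

(** Write Y_h = h F_h.  It has odd powers of h only, and the pullback of the
    composition is exp (A) exp (B) exp (A) with A = Y_{ah} and
    B = d sigma (Y_{bh}).  Three facts give the theorem.

    Existence of a logarithm.  The exponential of a series of derivations
    respects products of functions, hence so does a composition of such
    exponentials.  If the series exp (Z) and phi both respect products and
    agree below order m, then the difference of their coefficients of h^m is a
    derivation, that is, a vector field; adding it to Z_m extends the agreement
    to order m, since exp (Z)_m = Z_m + (terms in the Z_j with j < m).  This
    replaces the Baker-Campbell-Hausdorff formula ([log_exists]); the same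
    triangular shape makes the logarithm unique ([log_unique]).

    Even orders.  The word exp (A) exp (B) exp (A) is a palindrome in odd
    series, so h -> -h inverts it.  Hence Z_{-h} = - Z_h, and all even
    coefficients of Z_h vanish ([even_log_palindrome]), in particular the one of
    order 2p + 2.

    Orders up to m = 2p + 1.  Below order m both A and B are multiples of h F,
    because d sigma (F) = F; so commutators only appear beyond order m and
    Z = A + B + A up to order m ([exp_add_leading]).  The only coefficient that
    could fail to be symmetric is the one of h^m,
    2 a^m E_{2p} + b^m d sigma (E_{2p}), and the choice of a is exactly the one
    for which b^m = 2 a^m ([palindromic_coefficients]), which makes this vector
    field invariant under d sigma ([phi1_log_leading]).

    A formal map A acts on power series of functions by a Cauchy product
    ([act]), which turns the composition of formal maps into a composition of
    functions ([act_op_mul]) and makes the powers of a series of vector fields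
    plain iterates. *)

Section FormalSeries.
Set Implicit Arguments.
Unset Strict Implicit.
Unset Printing Implicit Defensive.

(** * Cauchy products *)

Section Cauchy.
Variable V : nmodType.

Lemma sum_triangle n (F : nat -> nat -> V) :
  \sum_(i < n.+1) \sum_(j < i.+1) F j (i - j)%N =
  \sum_(j < n.+1) \sum_(k < (n - j).+1) F j k.
Proof.
elim: n => [|n IH]; first by rewrite !big_ord1 /= ?big_ord1.
rewrite big_ord_recr [RHS]big_ord_recr /= IH [X in _ + X = _]big_ord_recr /=.
rewrite subnn big_ord1 addrA -big_split /=; congr (_ + _).
by apply: eq_bigr => j _; rewrite subSn ?big_ord_recr //= -ltnS.
Qed.

Lemma sum_triangle_exchange n (F : nat -> nat -> V) :
  \sum_(j < n.+1) \sum_(k < (n - j).+1) F j k =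
  \sum_(k < n.+1) \sum_(j < (n - k).+1) F j k.
Proof.
rewrite -sum_triangle -(sum_triangle n (fun k j => F j k)).
apply: eq_bigr => i _; rewrite [LHS](reindex_inj rev_ord_inj) /=.
apply: eq_bigr => j _; rewrite subSS; congr (F _ _).
by rewrite subKn // -ltnS.
Qed.

Lemma sum_trunc m n (F : nat -> V) : (m <= n)%N ->
  (forall k, (m <= k)%N -> F k = 0) -> \sum_(k < n) F k = \sum_(k < m) F k.
Proof.
move=> le_mn F0; rewrite -(big_mkord predT) (big_cat_nat (n := m)) //=.
by rewrite big_mkord [X in _ + X]big_nat [X in _ + X]big1 ?addr0 // => k /andP[mk _]; exact: F0.
Qed.

(** Both products of exponentials met below, that of exp (sX) and exp (tX) and
    that of exp (X) u and exp (X) v, are sums over a square of terms that vanish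
    beyond the antidiagonal. *)
Lemma sum_square_triangle n (F : nat -> nat -> V) :
  (forall i k, (n < i + k)%N -> F i k = 0) ->
  \sum_(i < n.+1) \sum_(k < n.+1) F i k =
  \sum_(m < n.+1) \sum_(i < m.+1) F i (m - i)%N.
Proof.
move=> F0; rewrite sum_triangle; apply: eq_bigr => i _.
by apply: sum_trunc => [|k ik]; [lia | apply: F0; lia].
Qed.

(** The pairing is arbitrary because the same product is used for functions,
    for operators, and for operators applied to functions. *)
Definition cauchy (A B : Type) (op : A -> B -> V) (u : nat -> A) (v : nat -> B) :
  nat -> V := fun n => \sum_(i < n.+1) op (u i) (v (n - i)%N).

Lemma eq_cauchy (A B : Type) (op : A -> B -> V) u u' v v' n :
  (forall i, (i <= n)%N -> u i = u' i) -> (forall i, (i <= n)%N -> v i = v' i) ->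
  cauchy op u v n = cauchy op u' v' n.
Proof.
by move=> uu vv; apply: eq_bigr => i _; rewrite uu ?vv ?leq_subr // -ltnS.
Qed.

Lemma cauchy_val (A B : nmodType) (op : A -> B -> V) u v a b :
  (forall x, op x 0 = 0) -> (forall y, op 0 y = 0) ->
  (forall i, (i < a)%N -> u i = 0) -> (forall i, (i < b)%N -> v i = 0) ->
  forall n, (n < a + b)%N -> cauchy op u v n = 0.
Proof.
move=> opr opl u0 v0 n lt_n; apply: big1 => i _.
have [ia|ai] := ltnP i a; first by rewrite u0.
by rewrite v0 ?opr //; have := ltn_ord i; lia.
Qed.

End Cauchy.

(** Additivity on the right is asked of the entries of [u] only: they may be
    operators on functions, and an arbitrary map of modules is not additive. *)
Lemma cauchyA (V W X : nmodType) (A B C : Type) (op1 : X -> C -> V)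
    (op2 : A -> B -> X) (op3 : A -> W -> V) (op4 : B -> C -> W) u v w :
  (forall x y z, op1 (op2 x y) z = op3 x (op4 y z)) ->
  (forall z, {morph op1^~ z : x y / x + y}) -> (forall z, op1 0 z = 0) ->
  (forall i, {morph op3 (u i) : x y / x + y}) -> (forall i, op3 (u i) 0 = 0) ->
  cauchy op1 (cauchy op2 u v) w = cauchy op3 u (cauchy op4 v w).
Proof.
move=> opA opD op0 opD' op0'; apply: funext => n; rewrite /cauchy.
transitivity (\sum_(i < n.+1) \sum_(j < i.+1)
    op3 (u j) (op4 (v (i - j)%N) (w (n - j - (i - j))%N))).
  apply: eq_bigr => i _; rewrite (big_morph (op1^~ _) (opD _) (op0 _)).
  apply: eq_bigr => j _; rewrite opA; congr (op3 _ (op4 _ (w _))).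
  by have := ltn_ord j; lia.
rewrite (sum_triangle n (fun j k => op3 (u j) (op4 (v k) (w (n - j - k)%N)))).
by apply: eq_bigr => j _; rewrite (big_morph (op3 (u j)) (opD' j) (op0' j)).
Qed.

(** If two pairs of series agree below order m + 1, their products differ at
    order m + 1 only through the two extreme terms.  With identity constant
    coefficients this says that first-order perturbations add up in a product;
    for the images of f and g under two multiplicative maps it becomes the
    Leibniz rule. *)
Lemma cauchy_top (V : zmodType) (A B : Type) (op : A -> B -> V) u u' v v' m :
  (forall i, (i < m.+1)%N -> u i = u' i) -> (forall i, (i < m.+1)%N -> v i = v' i) ->
  cauchy op u v m.+1 - cauchy op u' v' m.+1 =
  (op (u 0%N) (v m.+1) - op (u 0%N) (v' m.+1)) + (op (u m.+1) (v 0%N) - op (u' m.+1) (v 0%N)).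
Proof.
move=> uu vv; rewrite /cauchy !(big_ord_recl m.+1) !(big_ord_recr m) /= /bump !add1n subnn subn0.
rewrite -(uu 0%N) // -(vv 0%N) //.
rewrite (eq_bigr (fun i : 'I_m => op (u' i.+1) (v' (m.+1 - i.+1)%N))); first last.
  by move=> i _; rewrite uu ?vv //; have := ltn_ord i; lia.
rewrite opprD addrACA; congr (_ + _).
by rewrite opprD addrACA subrr add0r.
Qed.

(** * Formal maps acting on series of functions *)

Section Operators.
Variables (R : realType) (n : nat) (M : manifold R n).
Local Notation C := (Cinf M).
Implicit Types (X Y Z : nat -> vfield M) (A B : formal_map M) (u v w : nat -> C).

Lemma lie_linear (X : vfield M) : linear (lie X).
Proof.
move=> a f g; apply: val_inj; apply: funext => x /=.
by have [lX _] := vfield_tangent X x; exact: lX.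
Qed.

HB.instance Definition _ (X : vfield M) :=
  GRing.isLinear.Build R C C _ (lie X) (lie_linear X).

Lemma lie_leibniz (X : vfield M) (f g : C) :
  lie X (f * g) = lie X f * g + f * lie X g.
Proof.
apply: val_inj; apply: funext => x /=.
by have [_ dX] := vfield_tangent X x; exact: dX.
Qed.

Lemma scalerMM (c d : R) (f g : C) : (c *: f) * (d *: g) = (c * d) *: (f * g).
Proof. by apply: val_inj; apply: funext => x; exact: mulrACA. Qed.

Lemma lie_inj : injective (@lie R n M).
Proof.
move=> X Y XY; apply: val_inj; apply: funext => x; apply: funext => f.
by rewrite -[LHS]/(lie X f x) XY.
Qed.

Lemma lieE (c : R) (X Y : vfield M) f : lie (c *: X + Y) f = c *: lie X f + lie Y f.
Proof. by apply: val_inj; apply: funext. Qed.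

Lemma lieZ (c : R) (X : vfield M) f : lie (c *: X) f = c *: lie X f.
Proof. by apply: val_inj; apply: funext. Qed.

Lemma lie0 : lie (0 : vfield M) = 0.
Proof. by apply: funext => f; apply: val_inj; apply: funext. Qed.

(** Tangent vectors being derivations at a point, a derivation of the ring of
    smooth functions is a vector field: its smoothness comes from the type. *)
Lemma vfield_of_derivation (D : C -> C) : linear D ->
  (forall f g, D (f * g) = D f * g + f * D g) -> exists X : vfield M, lie X = D.
Proof.
move=> Dlin derD.
have tD : (fun x f => D f x) \in @vfield_pred R n M.
  apply/asboolP; split=> [x|f]; last exact: Cinf_smooth (D f).
  by split=> [a f g|f g]; rewrite ?Dlin ?derD.
exists (MkVfield tD); apply: funext => f; apply: val_inj; exact: funext.
Qed.

Definition act A u : nat -> C := cauchy (fun (D : C -> C) f => D f) A u.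
Definition const_series (f : C) : nat -> C := fun i => if i is 0 then f else 0.
Definition series_mul u v : nat -> C := cauchy *%R u v.
Definition fm_linear A := forall i, linear (A i).

Lemma linear_sum_scale (U W : lmodType R) (D : U -> W) m (c : 'I_m -> R) (f : 'I_m -> U) :
  linear D -> D (\sum_i c i *: f i) = \sum_i c i *: D (f i).
Proof.
move=> Dlin.
pose D' : {linear U -> W} := HB.pack D (GRing.isLinear.Build R U W _ D Dlin).
rewrite -[D]/(D' : U -> W) linear_sum; apply: eq_bigr => i _; exact: linearZ.
Qed.

Lemma linear_at0 (U W : lmodType R) (D : U -> W) : linear D -> D 0 = 0.
Proof.
move=> Dlin; have := linear_sum_scale (fun=> 0) (fun _ : 'I_0 => 0) Dlin.
by rewrite !big_ord0.
Qed.

Lemma linear_addE (U W : lmodType R) (D : U -> W) : linear D -> {morph D : x y / x + y}.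
Proof. by move=> Dlin x y; have := Dlin 1 x y; rewrite !scale1r. Qed.

Lemma act_linear A : fm_linear A -> linear (act A).
Proof.
move=> linA c u v; apply: funext => m; rewrite /act /cauchy.
rewrite -[RHS]/(c *: (\sum_(i < m.+1) A i (u (m - i)%N)) + \sum_(i < m.+1) A i (v (m - i)%N)).
by rewrite scaler_sumr -big_split; apply: eq_bigr => i _; exact: linA.
Qed.

Lemma act_const_series A f i : fm_linear A -> act A (const_series f) i = A i f.
Proof.
move=> linA; rewrite /act /cauchy big_ord_recr /= subnn big1 ?add0r // => j _.
rewrite -(linear_at0 (linA j)); congr (A _ _); have := ltn_ord j.
by case: (i - j)%N (subn_gt0 j i) => //= <-.
Qed.

Lemma op_mulE A B i f : op_mul A B i f = act A (fun j => B j f) i.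
Proof. by rewrite /op_mul fct_sumE. Qed.

(** Left linearity is needed because [op_mul] composes arbitrary functions:
    A (f + g) = A f + A g is not automatic. *)
Lemma act_op_mul A B u : fm_linear A -> act (op_mul A B) u = act A (act B u).
Proof.
move=> linA; apply: cauchyA => // [i|i]; [exact: linear_addE | exact: linear_at0].
Qed.

Lemma fm_linear_mul A B : fm_linear A -> fm_linear B -> fm_linear (op_mul A B).
Proof.
move=> linA lB i c f g; rewrite !op_mulE -[RHS]/((c *: act A (B^~ f) + act A (B^~ g)) i).
rewrite -act_linear //; congr (act A _ i); apply: funext => j; exact: lB.
Qed.

Lemma fm_linear_id : fm_linear (@op_id R n M).
Proof. by case=> [|i] c f g //=; rewrite /= scaler0 addr0. Qed.

Lemma act_id u : act (@op_id R n M) u = u.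
Proof.
apply: funext => m; rewrite /act /cauchy big_ord_recl /= subn0 big1 ?addr0 //.
Qed.

Lemma fm_linear_exp k A : fm_linear A -> fm_linear (op_exp k A).
Proof.
by move=> linA; elim: k => [|k IH]; [exact: fm_linear_id | exact: fm_linear_mul].
Qed.

Lemma act_op_exp k A u : fm_linear A -> act (op_exp k A) u = iter k (act A) u.
Proof.
move=> linA; elim: k => [|k IH]; first exact: act_id.
by rewrite /= -IH act_op_mul.
Qed.

Definition lies X : formal_map M := fun i => lie (X i).

Lemma fm_linear_lies X : fm_linear (lies X).
Proof. by move=> i; exact: lie_linear. Qed.
#[local] Hint Resolve fm_linear_lies : core.

Definition lie_pow X k u := iter k (act (lies X)) u.

Lemma lie_pow_linear X k : linear (lie_pow X k).
Proof.
move=> c u v; elim: k => //= k IH; rewrite {1}/lie_pow /= -/(lie_pow X k _) IH.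
exact: act_linear.
Qed.

(** A series without constant term raises the order in h; this is what makes
    the exponential series locally finite. *)
Lemma lie_pow_vanish X k u i : X 0%N = 0 -> (i < k)%N -> lie_pow X k u i = 0.
Proof.
move=> X0; elim: k i => // k IH i ik; rewrite /lie_pow /= -/(lie_pow X k _).
rewrite /act; apply: (big1 _) => -[[|j] /= ij] _; first by rewrite /lies X0 lie0.
rewrite IH; first exact: linear0.
move: ij ik => /=; lia.
Qed.

Lemma eq_lie_pow X k u v i : (forall j, (j <= i)%N -> u j = v j) -> lie_pow X k u i = lie_pow X k v i.
Proof.
elim: k i => [|k IH] i uv; first exact: uv.
apply: eq_cauchy => // j ji; apply: IH => l lj; apply: uv; lia.
Qed.

Lemma op_exp_vanish X k i : X 0%N = 0 -> (i < k)%N -> op_exp k (lies X) i = 0.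
Proof.
move=> X0 ik; apply: funext => f; rewrite -act_const_series; last exact: fm_linear_exp.
by rewrite act_op_exp //; exact: lie_pow_vanish.
Qed.

Lemma fexpE X i f : fexp X i f = \sum_(k < i.+1) (k`!%:R^-1 : R) *: op_exp k (lies X) i f.
Proof. by rewrite /fexp fct_sumE. Qed.

Lemma fm_linear_fexp X : fm_linear (fexp X).
Proof.
move=> i c f g; rewrite !fexpE scaler_sumr -big_split; apply: eq_bigr => k _ /=.
by rewrite fm_linear_exp // scalerDr scalerA mulrC -scalerA.
Qed.
#[local] Hint Resolve fm_linear_fexp : core.

(** The bound K may be taken common to all orders below it, whereas [fexp] stops
    at the order considered; products of exponentials need a common bound. *)
Lemma act_fexp X K u m : X 0%N = 0 -> (m < K)%N ->
  act (fexp X) u m = \sum_(k < K) (k`!%:R^-1 : R) *: lie_pow X k u m.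
Proof.
move=> X0 mK; rewrite (sum_trunc (m := m.+1) (F := fun k => k`!%:R^-1 *: lie_pow X k u m)) //; last first.
  by move=> k mk; rewrite lie_pow_vanish ?scaler0.
rewrite /act /cauchy.
transitivity (\sum_(i < m.+1) \sum_(k < m.+1)
    (k`!%:R^-1 : R) *: op_exp k (lies X) i (u (m - i)%N)).
  apply: eq_bigr => i _; rewrite fexpE.
  rewrite (sum_trunc (m := i.+1) (n := m.+1)
    (F := fun k => (k`!%:R^-1 : R) *: op_exp k (lies X) i (u (m - i)%N))) //.
  by move=> k ik; rewrite op_exp_vanish //; exact: scaler0.
rewrite exchange_big; apply: eq_bigr => k _.
by rewrite -scaler_sumr /lie_pow -act_op_exp.
Qed.

(** * Functional equation and multiplicativity of the exponential *)

Lemma leibniz_pascal (V : nmodType) k (G : nat -> nat -> V) :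
  \sum_(i < k.+1) (G i.+1 (k - i)%N + G i (k - i).+1) *+ 'C(k, i) =
  \sum_(i < k.+2) G i (k.+1 - i)%N *+ 'C(k.+1, i).
Proof.
rewrite [RHS]big_ord_recl /= bin0 mulr1n subn0.
under eq_bigr do rewrite mulrnDl.
under [X in _ = _ + X]eq_bigr do rewrite /bump add1n subSS binS mulrnDr.
rewrite !big_split /= addrA [LHS]addrC; congr (_ + _).
rewrite [in LHS]big_ord_recl /= bin0 mulr1n subn0 [in RHS]big_ord_recr /=.
rewrite bin_small // mulr0n addr0; congr (_ + _).
by apply: eq_bigr => i _; rewrite /bump add1n subnSK.
Qed.

(** The algebraic core of e^(x + y) = e^x e^y, where G i k stands for x^i y^k.
    It serves for [exp_add], where x and y are multiples of the same series, and
    for [exp_multiplicative], where x and y act on the two factors of a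
    product. *)
Lemma exp_double_sum (V : lmodType R) m (G : nat -> nat -> V) :
  (forall i k, (m < i + k)%N -> G i k = 0) ->
  \sum_(i < m.+1) \sum_(k < m.+1) (i`!%:R^-1 * k`!%:R^-1 : R) *: G i k =
  \sum_(l < m.+1) (l`!%:R^-1 : R) *: \sum_(i < l.+1) G i (l - i)%N *+ 'C(l, i).
Proof.
move=> G0; rewrite (sum_square_triangle (F := fun i k => (i`!%:R^-1 * k`!%:R^-1 : R) *: G i k)).
  apply: eq_bigr => l _; rewrite scaler_sumr; apply: eq_bigr => i _.
  have le_il : (i <= l)%N by rewrite -ltnS.
  rewrite -[G _ _ *+ _]scaler_nat scalerA -(bin_fact le_il) !natrM !invfM; congr (_ *: _).
  rewrite mulrAC -mulrA mulrA mulVf ?mul1r //.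
  by rewrite pnatr_eq0 -lt0n bin_gt0.
by move=> i k ik; rewrite G0 ?scaler0.
Qed.

Definition fscale (c : R) X : nat -> vfield M := fun i => c *: X i.

Lemma act_fscale c X u : act (lies (fscale c X)) u = c *: act (lies X) u.
Proof.
apply: funext => i; rewrite -[RHS]/(c *: act (lies X) u i) /act /cauchy scaler_sumr.
by apply: eq_bigr => j _; exact: lieZ.
Qed.

Lemma lie_pow_fscale c X k u : lie_pow (fscale c X) k u = c ^+ k *: lie_pow X k u.
Proof.
elim: k => [|k IH]; first by rewrite scale1r.
rewrite /lie_pow /= -!/(lie_pow _ _ _) act_fscale IH exprS -scalerA; congr (_ *: _).
pose f (_ : 'I_1) := lie_pow X k u.
have := linear_sum_scale (fun=> c ^+ k) f (act_linear (fm_linear_lies X)).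
by rewrite !big_ord1.
Qed.

(** Stated on the action on series: the iterates of the two multiples of X are
    all iterates of one function, so no commutation argument is needed. *)
Lemma exp_add s t X u : X 0%N = 0 ->
  act (fexp (fscale s X)) (act (fexp (fscale t X)) u) = act (fexp (fscale (s + t) X)) u.
Proof.
move=> X0; have cX0 c : fscale c X 0%N = 0 by rewrite /fscale X0 scaler0.
apply: funext => m; rewrite !(act_fexp (K := m.+1)) //.
pose G i k := (s ^+ i * t ^+ k) *: lie_pow X (i + k) u m.
transitivity (\sum_(i < m.+1) \sum_(k < m.+1) (i`!%:R^-1 * k`!%:R^-1 : R) *: G i k).
  apply: eq_bigr => i _; rewrite lie_pow_fscale.
  rewrite -[X in _ *: X = _]/(s ^+ i *: lie_pow X i _ m).
  rewrite (@eq_lie_pow X i _ (\sum_(k < m.+1) (k`!%:R^-1 * t ^+ k) *: lie_pow X k u) m); last first.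
    move=> j jm; rewrite (act_fexp (K := m.+1)) // fct_sumE; apply: eq_bigr => k _.
    by rewrite lie_pow_fscale -scalerA.
  rewrite (linear_sum_scale _ _ (@lie_pow_linear X i)) fct_sumE !scaler_sumr.
  apply: eq_bigr => k _; rewrite /G /lie_pow iterD.
  rewrite -[X in _ *: (_ *: X) = _]/((k`!%:R^-1 * t ^+ k) *: iter i _ _ m) !scalerA.
  by congr (_ *: _); ring.
rewrite exp_double_sum; last by move=> i k ik; rewrite /G lie_pow_vanish ?scaler0.
apply: eq_bigr => l _; congr (_ *: _); rewrite lie_pow_fscale.
rewrite -[RHS]/((s + t) ^+ l *: lie_pow X l u m) addrC exprDn scaler_suml.
apply: eq_bigr => i _; rewrite /G subnKC -?scalerMnl; last by rewrite -ltnS.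
by rewrite mulrC.
Qed.

Lemma series_mul_linear_l v : linear (series_mul^~ v).
Proof.
move=> c u w; apply: funext => m; rewrite /series_mul /cauchy.
rewrite -[RHS]/(c *: (\sum_(i < m.+1) u i * v (m - i)%N) + \sum_(i < m.+1) w i * v (m - i)%N).
rewrite scaler_sumr -big_split; apply: eq_bigr => i _ /=.
by rewrite -[v _ in LHS]scale1r mulrDl -{1}[v _]scale1r scalerMM mulr1 scale1r.
Qed.

Lemma series_mul_linear_r u : linear (series_mul u).
Proof.
move=> c v w; apply: funext => m; rewrite /series_mul /cauchy.
rewrite -[RHS]/(c *: (\sum_(i < m.+1) u i * v (m - i)%N) + \sum_(i < m.+1) u i * w (m - i)%N).
rewrite scaler_sumr -big_split; apply: eq_bigr => i _ /=.
by rewrite mulrDr -{1}[u _]scale1r scalerMM mul1r.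
Qed.

Lemma series_mul_vanish u v a b m : (forall i, (i < a)%N -> u i = 0) ->
  (forall i, (i < b)%N -> v i = 0) -> (m < a + b)%N -> series_mul u v m = 0.
Proof. by move=> u0 v0; apply: cauchy_val => // x; [exact: mulr0|exact: mul0r]. Qed.

Lemma act_lies_leibniz X u v :
  act (lies X) (series_mul u v) = series_mul (act (lies X) u) v + series_mul u (act (lies X) v).
Proof.
apply: funext => m; rewrite -[RHS]/(series_mul _ v m + series_mul u _ m).
transitivity (\sum_(i < m.+1) \sum_(j < (m - i).+1) (lies X i (u j) * v (m - i - j)%N)
   + \sum_(i < m.+1) \sum_(j < (m - i).+1) (u j * lies X i (v (m - i - j)%N))).
  rewrite -big_split; apply: eq_bigr => i _ /=.
  rewrite /series_mul /cauchy /lies linear_sum -big_split.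
  by apply: eq_bigr => j _; exact: lie_leibniz.
congr (_ + _).
  rewrite -(sum_triangle m (fun i j => lies X i (u j) * v (m - i - j)%N)).
  rewrite /series_mul /cauchy; apply: eq_bigr => i _; rewrite mulr_suml.
  apply: eq_bigr => j _; congr (_ * v _); have := ltn_ord j; lia.
rewrite (sum_triangle_exchange m (fun i j => u j * lies X i (v (m - i - j)%N))).
rewrite /series_mul /cauchy; apply: eq_bigr => i _; rewrite mulr_sumr.
by apply: eq_bigr => j _; rewrite subnAC.
Qed.

(** A derivation of the coefficients acts as a derivation of series, so its
    iterates obey the general Leibniz rule. *)
Lemma lie_pow_leibniz X k u v :
  lie_pow X k (series_mul u v) =
  \sum_(i < k.+1) series_mul (lie_pow X i u) (lie_pow X (k - i) v) *+ 'C(k, i).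
Proof.
elim: k => [|k IH]; first by rewrite big_ord1 bin0.
rewrite -(leibniz_pascal k (fun i j => series_mul (lie_pow X i u) (lie_pow X j v))).
rewrite /lie_pow /= -/(lie_pow X k _) IH.
rewrite [X in act _ X](eq_bigr (fun i : 'I_k.+1 =>
  ('C(k, i)%:R : R) *: series_mul (lie_pow X i u) (lie_pow X (k - i) v))); last first.
  by move=> i _; rewrite scaler_nat.
rewrite (linear_sum_scale _ _ (act_linear (fm_linear_lies X))).
by apply: eq_bigr => i _; rewrite scaler_nat act_lies_leibniz.
Qed.

(** The flow of a vector field acts on functions by pullback, which respects
    products; on formal series this is the general Leibniz rule divided by the
    factorials. *)
Lemma exp_multiplicative X u v : X 0%N = 0 ->
  act (fexp X) (series_mul u v) = series_mul (act (fexp X) u) (act (fexp X) v).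
Proof.
move=> X0; apply: funext => m; rewrite (act_fexp (K := m.+1)) //.
pose G i k := series_mul (lie_pow X i u) (lie_pow X k v) m.
transitivity (\sum_(i < m.+1) \sum_(k < m.+1) (i`!%:R^-1 * k`!%:R^-1 : R) *: G i k).
  rewrite exp_double_sum.
    apply: eq_bigr => l _; congr (_ *: _); rewrite lie_pow_leibniz fct_sumE.
    apply: eq_bigr => i _; rewrite /G; elim: 'C(_, _) => [|c IH] //.
    by rewrite !mulrS -IH.
  by move=> i k; apply: series_mul_vanish => j; exact: lie_pow_vanish.
pose e w : nat -> C := \sum_(k < m.+1) (k`!%:R^-1 : R) *: lie_pow X k w.
have eE w i : (i <= m)%N -> act (fexp X) w i = e w i.
  by move=> im; rewrite (act_fexp (K := m.+1)) // /e fct_sumE.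
rewrite [RHS](eq_cauchy _ (u' := e u) (v' := e v)) => [|i im|i im]; last 2 first.
- exact: eE.
- exact: eE.
rewrite -/(series_mul (e u) (e v)) {1}/e (linear_sum_scale _ _ (@series_mul_linear_l _)) fct_sumE.
apply: eq_bigr => i _; rewrite /e (linear_sum_scale _ _ (@series_mul_linear_r _)).
rewrite -[RHS]/(_ *: (\sum_(k < m.+1) _) m) fct_sumE scaler_sumr.
by apply: eq_bigr => k _; rewrite -scalerA.
Qed.

(** * Uniqueness and existence of the logarithm *)

Lemma fexp0 X : X 0%N = 0 -> fexp X 0%N = id.
Proof.
by move=> X0; apply: funext => f; rewrite fexpE big_ord1 /= invr1 scale1r.
Qed.

Lemma op_exp1 X : op_exp 1 (lies X) = lies X.
Proof.
apply: funext => i; apply: funext => f.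
rewrite -[LHS]/(op_mul (lies X) (op_exp 0 (lies X)) i f) op_mulE.
rewrite (_ : (fun j => op_exp 0 (lies X) j f) = const_series f) ?act_const_series //.
by apply: funext => -[|j].
Qed.

Lemma eq_op_exp X Y k i : (forall j, (j <= i)%N -> X j = Y j) ->
  op_exp k (lies X) i = op_exp k (lies Y) i.
Proof.
elim: k i => // k IH i XY; apply: eq_cauchy => j ji; first by rewrite /lies XY.
by apply: IH => l lj; apply: XY; lia.
Qed.

#[local] Arguments op_exp : simpl never.

(** A product of at least two factors of positive order cannot involve the
    coefficient of the top order. *)
Lemma eq_op_exp_top X Y k i : X 0%N = 0 -> (forall j, (j < i)%N -> X j = Y j) ->
  (0 < i)%N -> op_exp k.+2 (lies X) i = op_exp k.+2 (lies Y) i.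
Proof.
move=> X0 XY i0; have Y0 : Y 0%N = 0 by rewrite -XY.
apply: eq_bigr => j _; apply: funext => f.
rewrite -[LHS]/(lies X j (op_exp k.+1 (lies X) (i - j)%N f)).
rewrite -[RHS]/(lies Y j (op_exp k.+1 (lies Y) (i - j)%N f)).
have [->|j0] := posnP j; first by rewrite /lies X0 Y0 lie0.
have [ij|ij] := leqP i j.
  have -> : (i - j = 0)%N by lia.
  by rewrite !(op_exp_vanish (k := k.+1)) // /lies; rewrite [LHS]linear0 [RHS]linear0.
rewrite {1}/lies XY // (eq_op_exp (Y := Y)) // => l lj; apply: XY; lia.
Qed.

Lemma eq_fexp X Y i : (forall j, (j <= i)%N -> X j = Y j) -> fexp X i = fexp Y i.
Proof.
by move=> XY; apply: funext => f; rewrite !fexpE; apply: eq_bigr => k _; rewrite (eq_op_exp _ XY).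
Qed.

(** The top coefficient of X enters that of exp (X) additively, through the
    linear term of the exponential series: higher powers do not see it. *)
Lemma fexp_top X Y i f : X 0%N = 0 -> (forall j, (j < i)%N -> X j = Y j) -> (0 < i)%N ->
  fexp X i f = fexp Y i f + lie (X i - Y i) f.
Proof.
case: i => // i X0 XY _; rewrite !fexpE !(big_ord_recl i.+1) !(big_ord_recl i) /=.
rewrite /bump /= !op_exp1 -[RHS]addrA; congr (_ + _).
rewrite [RHS]addrAC; congr (_ + _).
  rewrite -[1`!%:R]/(1 : R) invr1 !scale1r /lies -[- Y _]scaleN1r.
  by rewrite [X _ + _]addrC lieE scaleN1r addrA subrr add0r.
by apply: eq_bigr => k _; rewrite (eq_op_exp_top _ _ XY).
Qed.

Lemma log_unique X Y i : X 0%N = 0 -> Y 0%N = 0 ->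
  (forall j, (j <= i)%N -> fexp X j = fexp Y j) -> forall j, (j <= i)%N -> X j = Y j.
Proof.
move=> X0 Y0 XY j; have [k] := ubnP j; elim: k j => // k IH j jk ji.
have [->|j0] := posnP j; first by rewrite X0.
apply/eqP; rewrite -subr_eq0; apply/eqP/lie_inj; rewrite lie0; apply: funext => f.
apply: (addrI (fexp Y j f)); rewrite -fexp_top // ?XY ?addr0 // => l lj.
by apply: IH; lia.
Qed.

Definition multiplicative A := forall u v, act A (series_mul u v) = series_mul (act A u) (act A v).

Lemma multiplicativeE A i f g : fm_linear A -> multiplicative A ->
  A i (f * g) = series_mul (A^~ f) (A^~ g) i.
Proof.
move=> linA mA; have acA h : act A (const_series h) = A^~ h.
  by apply: funext => j; rewrite act_const_series.
rewrite -!acA -mA -act_const_series //; congr (act A _ i); apply: funext => -[|j].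
  by rewrite /series_mul /cauchy big_ord1.
rewrite /series_mul /cauchy big1 // => -[[|l] lj] _ /=; first by rewrite mulr0.
by rewrite mul0r.
Qed.

(** Below order i + 1 the two multiplicative series agree and their constant
    coefficients are the identity, so [cauchy_top] turns multiplicativity of
    both into the Leibniz rule for the difference of their coefficients. *)
Lemma log_next_coef A Z i : fm_linear A -> multiplicative A -> A 0%N = id ->
  Z 0%N = 0 -> (forall j, (j < i.+1)%N -> fexp Z j = A j) ->
  exists X : vfield M, lie X = A i.+1 - fexp Z i.+1.
Proof.
move=> linA mA A0 Z0 ZA; apply: vfield_of_derivation => [c f g|f g].
  rewrite -[LHS]/(A i.+1 _ - fexp Z i.+1 _) linA fm_linear_fexp.
  by rewrite opprD addrACA -scalerBr.
rewrite -[LHS]/(A i.+1 _ - fexp Z i.+1 _).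
rewrite !multiplicativeE //; last by move=> u v; exact: exp_multiplicative.
rewrite /series_mul cauchy_top => [|j ji|j ji]; last 2 first.
- by rewrite ZA.
- by rewrite ZA.
by rewrite A0 -mulrBr -mulrBl addrC.
Qed.

Lemma log_exists A : fm_linear A -> multiplicative A -> A 0%N = id ->
  exists2 Z, Z 0%N = 0 & fexp Z = A.
Proof.
move=> linA mA A0.
(* Corrections up to order i give logarithms modulo h^(i+1); by uniqueness their
   coefficients are compatible, so the diagonal sequence is a logarithm. *)
have approx i : exists Z, Z 0%N = 0 /\ forall j, (j <= i)%N -> fexp Z j = A j.
  elim: i => [|i [Z [Z0 ZA]]].
    by exists (fun=> 0); split=> // -[|//] _; rewrite fexp0.
  have [X XE] := log_next_coef linA mA A0 Z0 ZA.
  exists (fun j => if j == i.+1 then Z j + X else Z j); split=> // j.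
  rewrite leq_eqVlt => /predU1P[->|ji]; last first.
    rewrite -ZA //; apply: eq_fexp => l lj; case: eqP => // li; lia.
  apply: funext => f; rewrite (@fexp_top _ Z) // => [|l li]; last first.
    by case: eqP => // li'; lia.
  rewrite eqxx [Z _ + X]addrC addrK XE.
  by rewrite -[LHS]/(fexp Z i.+1 f + (A i.+1 f - fexp Z i.+1 f)) addrC subrK.
have /choice[Zs ZsE] := approx.
exists (fun j => Zs j j) => [|]; first by case: (ZsE 0%N).
apply: funext => i; have [Z0 <- //] := ZsE i; apply: eq_fexp => j ji.
have [Zj0 Zj] := ZsE j; apply: (log_unique (i := j)) => // l lj.
by rewrite Zj //; case: (ZsE i) => _ -> //; lia.
Qed.

(** * Change of the step size and palindromic compositions *)

(** The substitution h -> c h on formal maps, as [hsubst] on vector fields. *)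
Definition twist (c : R) A : formal_map M := fun i f => c ^+ i *: A i f.

Lemma act_twist c A u : fm_linear A ->
  act (twist c A) (fun i => c ^+ i *: u i) = fun i => c ^+ i *: act A u i.
Proof.
move=> linA; apply: funext => i; rewrite /act /cauchy scaler_sumr.
apply: eq_bigr => j _; rewrite /twist -[c ^+ (i - j) *: _]addr0 linA (linear_at0 (linA j)) addr0.
by rewrite scalerA -exprD subnKC // -ltnS.
Qed.

Lemma op_mul_twist c A B : fm_linear A ->
  op_mul (twist c A) (twist c B) = twist c (op_mul A B).
Proof.
move=> linA; apply: funext => i; apply: funext => f.
by rewrite op_mulE (act_twist c _ linA) /twist op_mulE.
Qed.

Lemma lies_hsubst c X : lies (hsubst c X) = twist c (lies X).
Proof. by apply: funext => i; apply: funext => f; exact: lieZ. Qed.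

Lemma op_exp_twist c A k : fm_linear A -> op_exp k (twist c A) = twist c (op_exp k A).
Proof.
move=> linA; elim: k => [|k IH].
  apply: funext => -[|i]; apply: funext => f; first by rewrite /twist scale1r.
  by rewrite /twist -[op_exp 0 _ _ _]/(0 : C) scaler0.
by rewrite -[LHS]/(op_mul _ (op_exp k _)) IH op_mul_twist.
Qed.

Lemma fexp_hsubst c X : fexp (hsubst c X) = twist c (fexp X).
Proof.
apply: funext => i; apply: funext => f.
rewrite /twist !fexpE scaler_sumr; apply: eq_bigr => k _.
by rewrite lies_hsubst op_exp_twist // scalerA mulrC -scalerA.
Qed.

Lemma op_mul_exp_add s t X : X 0%N = 0 ->
  op_mul (fexp (fscale s X)) (fexp (fscale t X)) = fexp (fscale (s + t) X).
Proof.
move=> X0; apply: funext => i; apply: funext => f.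
rewrite -act_const_series; last by apply: fm_linear_mul; exact: fm_linear_fexp.
by rewrite act_op_mul // exp_add // act_const_series.
Qed.

(** Below order m the series X and Y are multiples of one series L, which
    commute; at order m their corrections enter additively on both sides by
    [cauchy_top] and [fexp_top].  Commutators of the corrections with L have
    order larger than m, since L has no constant term. *)
Lemma exp_add_leading a b L X Y m : L 0%N = 0 -> (0 < m)%N ->
  (forall j, (j < m)%N -> X j = a *: L j) -> (forall j, (j < m)%N -> Y j = b *: L j) ->
  forall j, (j <= m)%N -> op_mul (fexp X) (fexp Y) j = fexp (fun i => X i + Y i) j.
Proof.
move=> L0 m0 XL YL j.
have X0 : X 0%N = 0 by rewrite XL // L0 scaler0.
have Y0 : Y 0%N = 0 by rewrite YL // L0 scaler0.
have eX i : (i < m)%N -> fexp X i = fexp (fscale a L) i.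
  by move=> im; apply: eq_fexp => l li; rewrite XL //; lia.
have eY i : (i < m)%N -> fexp Y i = fexp (fscale b L) i.
  by move=> im; apply: eq_fexp => l li; rewrite YL //; lia.
have XYL l : (l < m)%N -> X l + Y l = fscale (a + b) L l.
  by move=> lm; rewrite XL // YL // /fscale scalerDl.
rewrite leq_eqVlt => /predU1P[->|jm]; last first.
  rewrite (@eq_fexp _ (fscale (a + b) L)) -?op_mul_exp_add => [|//|l lj]; last by apply: XYL; lia.
  by apply: eq_cauchy => i ij; [apply: eX | apply: eY]; lia.
case: m m0 XL YL eX eY XYL => // m _ XL YL eX eY XYL.
apply: funext => f; rewrite (@fexp_top _ (fscale (a + b) L)) //; last by rewrite X0 Y0 addr0.
rewrite -op_mul_exp_add // addrC; apply/eqP; rewrite -subr_eq; apply/eqP.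
rewrite !op_mulE /act cauchy_top => [|i /eX//|i /eY->//].
rewrite (fexp0 X0) (fexp0 Y0) (@fexp_top X (fscale a L)) // (@fexp_top Y (fscale b L)) //.
rewrite [X in X - _]addrC addrK [X in _ + (X - _)]addrC addrK.
rewrite -[X in X + _]scale1r -lieE scale1r; congr (lie _ f).
by rewrite /fscale scalerDl opprD [LHS]addrC [LHS]addrACA.
Qed.

Lemma multiplicative_mul A B : fm_linear A -> multiplicative A ->
  multiplicative B -> multiplicative (op_mul A B).
Proof. by move=> linA mA mB u v; rewrite !act_op_mul // mB mA. Qed.

Lemma op_mul_coef0 A B : A 0%N = id -> B 0%N = id -> op_mul A B 0%N = id.
Proof. by move=> A0 B0; rewrite /op_mul big_ord1 /= A0 B0. Qed.

Lemma exp_oppK X u : X 0%N = 0 ->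
  act (fexp (fscale (-1) X)) (act (fexp X) u) = u /\
  act (fexp X) (act (fexp (fscale (-1) X)) u) = u.
Proof.
move=> X0; have X1 : X = fscale 1 X by apply: funext => i; rewrite /fscale scale1r.
have act0 : act (fexp (fscale 0 X)) u = u.
  apply: funext => m; rewrite (act_fexp (K := m.+1)) //; last by rewrite /fscale scale0r.
  rewrite big_ord_recl fact0 invr1 scale1r big1 ?addr0 // => k _.
  by rewrite lift0 lie_pow_fscale exprS mul0r scale0r; exact: scaler0.
by split; [rewrite {2}X1 | rewrite {1}X1]; rewrite exp_add // ?addNr ?addrN.
Qed.

(** The substitution h -> -h inverts each exponential, and a palindrome is
    inverted by inverting its letters.  So exp (Z_{-h}) is the inverse of
    exp (Z_h), which is exp (- Z_h); uniqueness of the logarithm gives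
    Z_{-h} = - Z_h. *)
Lemma even_log_palindrome X Y Z i : X 0%N = 0 -> Y 0%N = 0 -> Z 0%N = 0 ->
  hsubst (-1) X = fscale (-1) X -> hsubst (-1) Y = fscale (-1) Y ->
  fexp Z = op_mul (op_mul (fexp X) (fexp Y)) (fexp X) -> ~~ odd i -> Z i = 0.
Proof.
move=> X0 Y0 Z0 oddX oddY ZE even_i.
have linXY : fm_linear (op_mul (fexp X) (fexp Y)) by exact: fm_linear_mul.
have inv u : act (fexp (hsubst (-1) Z)) (act (fexp Z) u) = u.
  rewrite fexp_hsubst ZE -!op_mul_twist // -!fexp_hsubst oddX oddY.
  rewrite !act_op_mul //; last exact: fm_linear_mul.
  by rewrite (exp_oppK _ X0).1 (exp_oppK _ Y0).1 (exp_oppK _ X0).1.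
have : hsubst (-1) Z i = fscale (-1) Z i.
  apply: (log_unique (i := i)) => //; rewrite ?/hsubst ?/fscale ?Z0 ?scaler0 // => j _.
  apply: funext => f; rewrite -!act_const_series // -{1}(exp_oppK (const_series f) Z0).2.
  by rewrite inv.
rewrite /hsubst /fscale -signr_odd (negPf even_i) scale1r scaleN1r => /eqP.
by rewrite -subr_eq0 opprK -mulr2n -(@scaler_nat R) scaler_eq0 pnatr_eq0 /= => /eqP.
Qed.

(** * The symmetry and the composition method *)

Section Symmetry.
Variables (S : smooth_map M M) (SK : involutive S).

Lemma dsigma_linear : linear (dsigma SK).
Proof. by move=> c X Y; apply: val_inj. Qed.

Lemma pullback_linear : linear (pullback S).
Proof. by move=> c f g; apply: val_inj. Qed.

Lemma pullbackK : involutive (pullback S).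
Proof. by move=> f; apply: val_inj; apply: funext => x /=; rewrite SK. Qed.

Lemma dsigmaK : involutive (dsigma SK).
Proof.
move=> X; apply: lie_inj; apply: funext => f; apply: val_inj; apply: funext => x.
by rewrite /= /tmap SK pullbackK.
Qed.

Lemma lie_dsigma (X : vfield M) f : lie (dsigma SK X) f = pullback S (lie X (pullback S f)).
Proof. by apply: val_inj. Qed.

Lemma fsigmaE A i f : fm_linear A -> fsigma S A i f = pullback S (A i (pullback S f)).
Proof.
move=> linA; have fS0 g : act (fmap_of S) g i = pullback S (g i).
  by rewrite /act /cauchy big_ord_recl subn0 big1 ?addr0.
rewrite /fsigma /fcomp op_mulE.
rewrite (_ : (fun j => fmap_of S j f) = const_series (pullback S f)); last by apply: funext => -[].
rewrite act_const_series ?op_mulE ?fS0 //; apply: fm_linear_mul => // -[|j]; first exact: pullback_linear.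
by move=> c g h; rewrite -[LHS]/(0 : C) -[RHS]/(c *: (0 : C) + 0) scaler0 addr0.
Qed.

Lemma op_exp_dsigma X k i f : op_exp k (lies (fun j => dsigma SK (X j))) i f =
  pullback S (op_exp k (lies X) i (pullback S f)).
Proof.
elim: k i f => [|k IH] i f.
  case: i => [|i]; first by rewrite -[LHS]/f -[LHS]pullbackK.
  by rewrite -[LHS]/(0 : C) -[RHS]/(pullback S 0) (linear_at0 pullback_linear).
rewrite -[LHS]/(op_mul (lies _) (op_exp k _) i f).
rewrite -[op_exp k.+1 (lies X)]/(op_mul (lies X) (op_exp k (lies X))) !op_mulE /act /cauchy.
rewrite (big_morph _ (linear_addE pullback_linear) (linear_at0 pullback_linear)).
by apply: eq_bigr => j _; rewrite IH /lies lie_dsigma pullbackK.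
Qed.

(** Conjugation by the symmetry is an automorphism for composition, hence passes
    inside the exponential. *)
Lemma fsigma_exp X : fsigma S (fexp X) = fexp (fun i => dsigma SK (X i)).
Proof.
apply: funext => i; apply: funext => f; rewrite fsigmaE // !fexpE.
rewrite (linear_sum_scale _ _ pullback_linear); apply: eq_bigr => k _.
by rewrite -op_exp_dsigma.
Qed.

Lemma fflow_exp X a : fflow X a (a * 1) = fexp (hsubst a (hmul 1 X)).
Proof.
congr (fexp _); apply: funext => -[|j]; first by rewrite /hsubst /= scaler0.
by rewrite /hsubst /= mulr1 scale1r scalerA exprS.
Qed.

Lemma phi1E X a b (A := hsubst a (hmul 1 X))
    (B := fun i => dsigma SK (hsubst b (hmul 1 X) i)) :
  phi1 S X a b 1 = op_mul (op_mul (fexp A) (fexp B)) (fexp A).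
Proof. by rewrite /phi1 !fflow_exp fsigma_exp. Qed.

Lemma dsigma0 : dsigma SK 0 = 0. Proof. exact: linear_at0 dsigma_linear. Qed.

Lemma dsigmaZ c (X : vfield M) : dsigma SK (c *: X) = c *: dsigma SK X.
Proof. by rewrite -[c *: X]addr0 dsigma_linear dsigma0 addr0. Qed.

Lemma phi1_log_exists X a b :
  exists2 Z, Z 0%N = 0 & fexp Z = phi1 S X a b 1.
Proof.
rewrite phi1E; set A := hsubst a _; set B := fun i => dsigma SK _.
have A0 : A 0%N = 0 by rewrite /A /hsubst scaler0.
have B0 : B 0%N = 0 by rewrite /B /hsubst scaler0 dsigma0.
have mA : multiplicative (fexp A) by move=> u v; exact: exp_multiplicative.
have mB : multiplicative (fexp B) by move=> u v; exact: exp_multiplicative.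
apply: log_exists.
- by apply: fm_linear_mul => //; exact: fm_linear_mul.
- by apply: multiplicative_mul => //; [exact: fm_linear_mul | exact: multiplicative_mul].
- by rewrite !op_mul_coef0 // fexp0.
Qed.

(** The step size multiplies the modified field, so a field in even powers of h
    contributes odd powers to the exponents. *)
Lemma phi1_log_even X a b Z i : (forall j, odd j -> X j = 0) -> Z 0%N = 0 ->
  fexp Z = phi1 S X a b 1 -> ~~ odd i -> Z i = 0.
Proof.
move=> evenX Z0; have oddX c : hsubst (-1) (hsubst c (hmul 1 X)) = fscale (-1) (hsubst c (hmul 1 X)).
  apply: funext => -[|j]; rewrite /hsubst /fscale /= ?scaler0 // scale1r.
  have [/evenX->|ej] := boolP (odd j); first by rewrite !scaler0.
  by rewrite -[(-1) ^+ _]signr_odd /= ej.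
rewrite phi1E; apply: even_log_palindrome => //; rewrite ?/hsubst ?scaler0 ?dsigma0 //.
apply: funext => j; have := congr1 (fun Y => dsigma SK (Y j)) (oddX b).
by rewrite /fscale {1}/hsubst !dsigmaZ.
Qed.

(** For j < m the coefficient Z_j is a multiple of F.  At order m it is
    2 a^m V + b^m d sigma (V) with V the coefficient of order m - 1 of the
    modified field, and the condition on a and b makes the two weights
    equal. *)
Lemma phi1_log_leading (F : vfield M) X a b Z m : dsigma SK F = F -> (1 < m)%N ->
  X 0%N = F -> (forall j, (0 < j < m.-1)%N -> X j = 0) -> b ^+ m = 2 * a ^+ m ->
  Z 0%N = 0 -> fexp Z = phi1 S X a b 1 ->
  forall j, (j <= m)%N -> dsigma SK (Z j) = Z j.
Proof.
move=> symF m1 X0 Xj bm Z0; rewrite phi1E; set A := hsubst a _; set B := fun i => dsigma SK _ => ZE.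
(* L is the series h F, to which A and B are proportional below order m. *)
pose L i := if i == 1%N then F else 0.
have YL i : (i < m)%N -> hmul 1 X i = L i.
  case: i => [|[|i]] im //=; first by rewrite X0 scale1r.
  by rewrite Xj ?scaler0 //; lia.
have aL c i : c ^+ i *: L i = c *: L i.
  by rewrite /L; case: eqP => [->|]; rewrite ?expr1 ?scaler0.
have symL i : dsigma SK (L i) = L i by rewrite /L; case: eqP; rewrite ?dsigma0.
have AL i : (i < m)%N -> A i = a *: L i by move=> im; rewrite /A /hsubst YL // aL.
have BL i : (i < m)%N -> B i = b *: L i.
  by move=> im; rewrite /B /hsubst YL // aL dsigmaZ symL.
have ABL i : (i < m)%N -> A i + B i = (a + b) *: L i.
  by move=> im; rewrite AL // BL // scalerDl.
have L0 : L 0%N = 0 by [].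
have m0 : (0 < m)%N by lia.
pose W i := A i + B i + A i.
have W0 : W 0%N = 0 by rewrite /W ABL ?AL ?L0 ?scaler0 ?addr0.
have ZW j : (j <= m)%N -> fexp Z j = fexp W j.
  move=> jm; rewrite ZE -(exp_add_leading L0 m0 ABL AL jm).
  apply: eq_cauchy => // i ij.
  by apply: (exp_add_leading L0 m0 AL BL); lia.
move=> j jm; rewrite (log_unique Z0 W0 ZW jm).
have addS U V : dsigma SK (U + V) = dsigma SK U + dsigma SK V.
  exact: linear_addE dsigma_linear U V.
move: jm; rewrite leq_eqVlt => /predU1P[->|jm]; last first.
  by rewrite /W ABL // AL // addS !dsigmaZ symL.
rewrite /W !addS /B /A /hsubst !dsigmaZ dsigmaK bm -[2]/(1 + 1) mulrDl mul1r !scalerDl.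
by rewrite [LHS]addrAC [RHS]addrAC addrC.
Qed.
End Symmetry.

(** The two equations give b = c a, where c is the (2p + 1)-th root of 2. *)
Lemma palindromic_coefficients (a b : R) p :
  a = (2 + 2 `^ ((2 * p + 1)%:R^-1))^-1 -> b = 1 - 2 * a ->
  b ^+ (2 * p + 1) = 2 * a ^+ (2 * p + 1).
Proof.
set c := 2 `^ _ => aE bE; have c0 : 0 < c by exact: powR_gt0.
have -> : b = c * a.
  by rewrite bE aE; field; apply/lt0r_neq0/addr_gt0.
rewrite exprMn; congr (_ * _).
by rewrite -powR_mulrn ?powR_ge0 // /c -powRrM mulVf ?powRr1 //.
Qed.

End Operators.
End FormalSeries.

Theorem proposition5 (R : realType) (n : nat) (M : manifold R n)
    (S : smooth_map M M) (F : vfield M) (p : nat) (E : nat -> vfield M)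
    (a b : R)
    (S_diffeo : diffeomorphism S)
    (S_neq_id : (S : M -> M) <> id)
    (SK : involutive S)
    (F_sym : forall x : M, tmap S (F x) = F (S x))
    (p_ge1 : (1 <= p)%N)
    (def_a : a = (2 + 2 `^ ((2 * p + 1)%:R^-1))^-1)
    (def_b : b = 1 - 2 * a) :
  let phi := phi1 S (modified_field p F E) a b 1 in
  retains_symmetry SK (2 * p + 2) phi /\
  (forall Z : nat -> vfield M, Z 0%N = 0 -> fexp Z = phi ->
     is_bigO (2 * p + 3) (fun j => p_component SK (Z j))).
Proof.
move=> phi.
have symF : dsigma SK F = F.
  by apply: val_inj; apply: funext => x; rewrite /= F_sym SK.
have main (Z : nat -> vfield M) : Z 0%N = 0 -> fexp Z = phi ->
    is_bigO (2 * p + 3) (fun j => p_component SK (Z j)).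
  move=> Z0 Zphi j jlt.
  suff symZ : dsigma SK (Z j) = Z j by rewrite /p_component symZ subrr scaler0.
  (* The one remaining order above 2p + 1 is 2p + 2, which is even. *)
  have [jm|mj] := leqP j (2 * p + 1).
    apply: (phi1_log_leading symF _ _ _ (palindromic_coefficients def_a def_b) Z0 Zphi jm).
    - lia.
    - by [].
    - by move=> i ip; rewrite /modified_field !ifF //; lia.
  rewrite (phi1_log_even SK _ Z0 Zphi) ?dsigma0 //; last first.
    have -> : j = (2 * p.+1)%N by lia.
    by rewrite oddM.
  by move=> i oi; rewrite /modified_field oi andbF; case: i oi.
split=> //; have [Z Z0 Zphi] := phi1_log_exists SK (modified_field p F E) a b.
by exists Z; split=> //; rewrite -addn1 -addnA; exact: main.
Qed.
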